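(* Let $m,n$ be coprime positive integers with $m>n$. Then the coefficient of $F_{[n-1]}(X)$ in the Hikita polynomial $\mathcal H_{m,n}(X;q,t)$ (expanded in the fundamental quasisymmetric functions $F_S(X)$, $S\subseteq[n-1]$) equals the rational $q,t$-Catalan polynomial $C_{m-n,n}(q,t)$.
   Context: For coprime positive integers $a,n$: the $(a,n)$-diagram consists of the unit cells $(u,v)$, $1\le u\le a$, $1\le v\le n$, where cell $(u,v)$ is the unit square in $[0,a]\times[0,n]$ with northeast corner $(u,v)$. The rank of cell $(u,v)$ is $\gamma(u,v)=an-un-(n+1-v)a$. An $(a,n)$-Dyck path $\pi$ is a lattice path from $(0,0)$ to $(a,n)$ with unit north and east steps never going strictly below the line $y=\frac{n}{a}x$. Cells northwest of the path are ''above the path'', the others ''below the path''. For each north step, the cell whose western edge is that step is ''on the path''; $R(\pi)$ is the set of the $n$ ranks of these cells. $\mathrm{area}(\pi)$ is the number of cells below $\pi$ with positive rank. For a cell $c$ above $\pi$, $\mathrm{arm}(c)$ (resp. $\mathrm{leg}(c)$) is the number of cells above $\pi$ strictly east of $c$ in its row (resp. strictly south of $c$ in its column); $c$ is a dinv cell if $\frac{\mathrm{arm}(c)}{\mathrm{leg}(c)+1}<\frac{a}{n}<\frac{\mathrm{arm}(c)+1}{\mathrm{leg}(c)}$ (division by $0$ is $+\infty$); $\mathrm{dinv}(\pi)$ is the number of dinv cells. The rational $q,t$-Catalan polynomial is $C_{a,n}(q,t)=\sum_\pi q^{\mathrm{dinv}(\pi)}t^{\mathrm{area}(\pi)}$ over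 all $(a,n)$-Dyck paths. Parking functions: an $(m,n)$-parking function is a pair $P=(\pi,W)$ with $\pi$ an $(m,n)$-Dyck path and $W=(w_1,\dots,w_n)$ an ordering of $R(\pi)$ such that whenever $k,k+m\in R(\pi)$, $k$ appears left of $k+m$ in $W$. Set $\mathrm{area}(P)=\mathrm{area}(\pi)$, $\mathrm{des}(P)=\{i\in[n-1]:w_i>w_{i+1}\}$, $\mathrm{inv}(P)=\#\{(i,j):1\le i<j\le n,\ w_j<w_i<w_j+m\}$, $\mathrm{dinv}(P)=\mathrm{dinv}(\pi)-\mathrm{inv}(P)$. Fundamental quasisymmetric functions (convention used here): for $S\subseteq[n-1]$, $F_S(X)=\sum x_{i_1}\cdots x_{i_n}$ over $i_1\le\cdots\le i_n$ with $i_j<i_{j+1}$ whenever $j\notin S$. The Hikita polynomial is $\mathcal H_{m,n}(X;q,t)=\sum_P t^{\mathrm{area}(P)}q^{\mathrm{dinv}(P)}F_{\mathrm{des}(P)}(X)$ over all $(m,n)$-parking functions $P$. *)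

(* Defs.v *)
From mathcomp Require Import all_boot all_order all_algebra.
From mathcomp Require Export finmap multiset.

Set Implicit Arguments.
Unset Strict Implicit.
Unset Printing Implicit Defensive.

Import Order.TTheory GRing.Theory Num.Theory.
Local Open Scope mset_scope.
Local Open Scope ring_scope.

(* A path is the sequence of its [a + n] unit steps, where [true] is a north   *)
(* step and [false] an east step. [xpos w k] and [ypos w k] are the            *)
(* coordinates of the lattice point reached after the first [k] steps.         *)
Definition lpath (a n : nat) := (a + n).-tuple bool.

Definition xpos a n (w : lpath a n) (k : nat) : nat := count negb (take k w).
Definition ypos a n (w : lpath a n) (k : nat) : nat := count id (take k w).

(* The path goes from (0,0) to (a,n), and its lattice points satisfy           *)
(* [y >= (n / a) x].                                                           *)
Definition is_dyck a n (w : lpath a n) : bool :=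
  [&& xpos w (a + n) == a, ypos w (a + n) == n &
      [forall k : 'I_(a + n).+1, (n * xpos w k <= a * ypos w k)%N]].

(* The rank of the cell with northeast corner (u,v), where u and v are >= 1.   *)
Definition rank (a n u v : nat) : int :=
  a%:Z * n%:Z - u%:Z * n%:Z - (n%:Z + 1 - v%:Z) * a%:Z.

(* The pair [c : cell a n] of 0-based ordinals is the cell whose northeast     *)
(* corner is [(c.1.+1, c.2.+1)].                                               *)
Definition cell (a n : nat) := ('I_a * 'I_n)%type.

(* A cell lies northwest of the path iff the north step of the path in the row *)
(* of the cell is weakly east of the eastern edge of the cell.                 *)
Definition above a n (w : lpath a n) (c : cell a n) : bool :=
  [exists k : 'I_(a + n),
    [&& tnth w k, ypos w k == c.2 & (c.1.+1 <= xpos w k)%N]].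

(* R(w): a north step starting at (x,y) is the western edge of the cell with   *)
(* northeast corner (x+1,y+1).                                                 *)
Definition Rranks a n (w : lpath a n) : seq int :=
  [seq rank a n (xpos w k).+1 (ypos w k).+1
     | k : 'I_(a + n) <- enum 'I_(a + n) & tnth w k].

Definition area a n (w : lpath a n) : nat :=
  #|[set c : cell a n | ~~ above w c & 0 < rank a n c.1.+1 c.2.+1]|.

Definition arm a n (w : lpath a n) (c : cell a n) : nat :=
  #|[set d : cell a n | [&& above w d, d.2 == c.2 & (c.1 < d.1)%N]]|.

Definition leg a n (w : lpath a n) (c : cell a n) : nat :=
  #|[set d : cell a n | [&& above w d, d.1 == c.1 & (d.2 < c.2)%N]]|.

(* The case [leg w c == 0] is the convention (arm + 1) / 0 = +oo.              *)
Definition dinv_cell a n (w : lpath a n) (c : cell a n) : bool :=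
  [&& above w c,
      (arm w c)%:R / (leg w c).+1%:R < a%:R / n%:R :> rat &
      (leg w c == 0%N) ||
      (a%:R / n%:R < (arm w c).+1%:R / (leg w c)%:R :> rat)].

Definition dinv a n (w : lpath a n) : nat :=
  #|[set c : cell a n | dinv_cell w c]|.

(* Z[q,t] is encoded as Z[q][t], and [qtfrac] is its field of fractions.       *)
Definition qtpoly := {poly {poly int}}.
Definition qvar : qtpoly := 'X%:P.
Definition tvar : qtpoly := 'X.
Definition qtfrac := {fraction qtpoly}.

(* C_{a,n}(q,t) *)
Definition qtCatalan (a n : nat) : qtpoly :=
  \sum_(w : lpath a n | is_dyck w) qvar ^+ dinv w * tvar ^+ area w.

(* [W] is an ordering of R(w) for which (w, W) is an (m,n)-parking function.   *)
Definition is_parking m n (w : lpath m n) (W : seq int) : bool :=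
  [&& is_dyck w, perm_eq W (Rranks w) &
      all (fun k : int => (k + m%:Z \in Rranks w) ==>
                          (index k W < index (k + m%:Z)%R W)%N) (Rranks w)].

(* The descent set; [i : 'I_n.-1] stands for the element [i.+1] of [n-1].      *)
Definition des (n : nat) (W : seq int) : {set 'I_n.-1} :=
  [set i : 'I_n.-1 | W`_i > W`_i.+1].

Definition inversions (m n : nat) (W : seq int) : nat :=
  #|[set p : 'I_n * 'I_n |
      (p.1 < p.2)%N & W`_p.2 < W`_p.1 < W`_p.2 + m%:Z]|.

Definition pdinv m n (w : lpath m n) (W : seq int) : int :=
  (dinv w)%:Z - (inversions m n W)%:Z.

(* Formal power series in x_0, x_1, x_2, ... over [qtfrac]: the monomial       *)
(* x_{i_1} ... x_{i_n} is the multiset of its indices, and a series maps each  *)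
(* monomial to its coefficient.                                                *)
Definition pseries := {mset nat} -> qtfrac.

(* The condition on (i_1, ..., i_n) in the sum defining F_S:                   *)
(* i_1 <= ... <= i_n, with i_j < i_{j+1} whenever j is not in S.               *)
Definition compatible n (S : {set 'I_n.-1}) (s : seq nat) : bool :=
  [&& size s == n,
      [forall j : 'I_n.-1, (nth 0 s j <= nth 0 s j.+1)%N] &
      [forall j : 'I_n.-1, (j \notin S) ==> (nth 0 s j < nth 0 s j.+1)%N]].

(* F_S(X): the index sequences whose monomial is [mu] are the permutations of  *)
(* the multiset [mu], and [permutations] lists each of them once.              *)
Definition Fqsym n (S : {set 'I_n.-1}) : pseries :=
  fun mu => (count (compatible S) (permutations (mu : seq nat)))%:R.

(* H_{m,n}(X;q,t). The exponent of q is an integer, hence the field of         *)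
(* fractions. [permutations] is duplicate-free, so each parking function       *)
(* [(w, W)] occurs exactly once.                                               *)
Definition Hikita (m n : nat) : pseries :=
  fun mu =>
    \sum_(w : lpath m n | is_dyck w)
      \sum_(W <- permutations (Rranks w) | is_parking w W)
        (tofrac tvar) ^+ area w * (tofrac qvar) ^ pdinv w W
        * Fqsym (des n W) mu.

(* [f] is the linear combination of the F_S with coefficients [c S].           *)
Definition F_expansion (n : nat) (f : pseries) (c : {set 'I_n.-1} -> qtfrac) :=
  forall mu : {mset nat}, f mu = \sum_(S : {set 'I_n.-1}) c S * Fqsym S mu.

(* Main.v *)
Require Import Defs.
From mathcomp Require Import all_boot all_order all_algebra.
From mathcomp Require Import zify.

(* The F_S are linearly independent, so the coefficient of F_[n-1] collects    *)
(* the parking functions (w, W) with W decreasing. Such a W exists, and is     *)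
(* then unique, iff R(w) contains no pair k, k + m, that is, iff w has no two  *)
(* consecutive north steps. Then every north step of w is followed by an east  *)
(* step, and deleting these n east steps yields an arbitrary (m-n,n)-Dyck path *)
(* w'. Measured by the level a y - n x (the rank shifted by n), the steps of   *)
(* w' start where the corresponding steps of w do; hence R and area are        *)
(* preserved.                                                                  *)
(* As for dinv, it counts the pairs of an east step E before a north step N    *)
(* with L(N) < L(E) < L(N) + a + n. Comparing w with w' for a fixed N, the     *)
(* identity dinv w = dinv w' + inv W amounts to the fact that the initial part *)
(* of w' crosses the level L(N) + m upwards as often as downwards, since it    *)
(* starts and ends below that level.                                           *)

Set Implicit Arguments.
Unset Strict Implicit.
Unset Printing Implicit Defensive.

Import Order.TTheory GRing.Theory Num.Theory.
Local Open Scope ring_scope.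

(** * Words of steps, their levels, and sums over steps *)

Definition level (a n : nat) (s : seq bool) : int :=
  a%:Z * (count id s)%:Z - n%:Z * (count negb s)%:Z.

(* [H] is applied to the steps before a given step and to that step. *)
Definition step_sum (H : seq bool -> bool -> nat) (s : seq bool) : nat :=
  (\sum_(k < size s) H (take k s) (nth false s k))%N.

Fixpoint expand (s : seq bool) : seq bool :=
  if s is b :: s' then
    if b then [:: true, false & expand s'] else false :: expand s'
  else [::].

(* [prev] tells whether the step just before [s] was north; the step after a  *)
(* north step is dropped, whatever it is.                                      *)
Fixpoint contract (prev : bool) (s : seq bool) : seq bool :=
  if s is b :: s' then
    if prev then contract false s' else b :: contract b s'
  else [::].

(** Used as [path not_both false (rcons s true)]: the appended north step is a sentinel that also
    forbids a final north step, so that every north step of [s] is followed by an east step. *)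
Definition not_both (b c : bool) := ~~ (b && c).

Lemma level_rcons a n s b :
  level a n (rcons s b) = level a n s + (if b then a%:Z else - n%:Z).
Proof. by rewrite /level -cats1 !count_cat /=; case: b => /=; lia. Qed.

Lemma step_sum_nil H : step_sum H [::] = 0%N.
Proof. by rewrite /step_sum big_ord0. Qed.

Lemma step_sum_rcons H s b :
  step_sum H (rcons s b) = (step_sum H s + H s b)%N.
Proof.
rewrite /step_sum size_rcons big_ord_recr /= nth_rcons ltnn eqxx.
rewrite -cats1 take_size_cat //; congr (_ + _)%N.
apply: eq_bigr => k _; rewrite nth_cat ltn_ord takel_cat //.
exact: ltnW.
Qed.

Lemma eq_step_sum H1 H2 s :
  (forall k, (k < size s)%N ->
     H1 (take k s) (nth false s k) = H2 (take k s) (nth false s k)) ->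
  step_sum H1 s = step_sum H2 s.
Proof. by move=> eqH; apply: eq_bigr => k _; apply: eqH. Qed.

(** The steps satisfying [p] are numbered by how many such steps precede them. With [id] this
    reindexes rows by north steps, with [negb] columns by east steps. *)
Lemma sum_count n (p : pred bool) (G : nat -> nat) s : count p s = n ->
  (\sum_(i < n) G i)%N =
  step_sum (fun u b => if p b then G (count p u) else 0%N) s.
Proof.
move=> <-; elim/last_ind: s => [|s b IH]; first by rewrite step_sum_nil big_ord0.
rewrite step_sum_rcons -IH -cats1 count_cat /= addn0.
by case: (p b); rewrite ?addn1 ?big_ord_recr ?addn0.
Qed.

Lemma sum_interval a A B : (B <= a)%N ->
  (\sum_(v < a) ((A <= v) && (v < B)) = B - A)%N.
Proof.
elim: a B => [|a IH] B leBa; first by rewrite big_ord0; lia.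
rewrite big_ord_recr /=; have [ltBa|ltaB] := leqP B a.
  by rewrite IH //; lia.
have eqB (i : 'I_a) : ((A <= i) && (i < B) = (A <= i) && (i < a))%N.
  by have := ltn_ord i; lia.
under eq_bigr => i _ do rewrite eqB.
by rewrite IH //; lia.
Qed.

Lemma count_take_lt (p : pred bool) s j k :
  (k <= size s)%N -> (j < k)%N -> p (nth false s j) ->
  (count p (take j s) < count p (take k s))%N.
Proof.
move=> ks jk pj.
have js : (j < size s)%N by lia.
apply: (@leq_trans (count p (take j.+1 s))).
  by rewrite (take_nth false) // -cats1 count_cat /= pj; lia.
rewrite -(subnKC jk) takeD count_cat; lia.
Qed.

Lemma count_take_le (p : pred bool) s j k :
  (j <= k)%N -> (count p (take j s) <= count p (take k s))%N.
Proof. by move=> jk; rewrite -(subnKC jk) takeD count_cat leq_addr. Qed.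

(** * Inserting and deleting an east step after each north step *)

Lemma expand_rcons s b :
  expand (rcons s b) =
  if b then rcons (rcons (expand s) true) false else rcons (expand s) false.
Proof. by case: b; elim: s => [|[] s IH] //=; rewrite IH. Qed.

Lemma contractK p s :
  path not_both p (rcons s true) ->
  (if p then false :: expand (contract p s) else expand (contract p s)) = s.
Proof.
elim: s p => [|b s IH] [] //=.
- by case: b => //= /IH ->.
- by case: b => //= /IH ->.
Qed.

Lemma expandK s : contract false (expand s) = s.
Proof. by elim: s => [|[] s IH] //=; rewrite IH. Qed.

Lemma path_expand s : path not_both false (rcons (expand s) true).
Proof. by elim: s => [|[] s IH] //=. Qed.

Lemma level_expand m n s : (n < m)%N ->
  level m n (expand s) = level (m - n) n s.
Proof.
move=> nm; elim/last_ind: s => [|s b IH]; first by rewrite /level /=; lia.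
by rewrite expand_rcons; case: b; rewrite !level_rcons IH; lia.
Qed.

Lemma count_expand s : count id (expand s) = count id s.
Proof. by elim: s => [|[] s IH] //=; rewrite IH. Qed.

Lemma size_expand s : size (expand s) = (size s + count id s)%N.
Proof. by elim: s => [|[] s IH] //=; rewrite IH; lia. Qed.

(** * Level crossings and the dinv identity for one row *)

(** The left sum counts the downward crossings of level [T], the right sum the upward ones. The word
    starts at level 0, below [T], so they differ by one exactly when it ends at or above [T]. *)
Lemma crossing a n (T : int) s : 0 < T ->
  (step_sum (fun u b => ~~ b && (T <= level a n u < T + n%:Z)%R) s
     + (T <= level a n s)%R =
   step_sum (fun u b => b && (T - a%:Z <= level a n u < T)%R) s)%N.
Proof.
move=> T0; elim/last_ind: s => [|s b IH].
  by rewrite !step_sum_nil /level /=; lia.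
rewrite !step_sum_rcons level_rcons -IH.
by case: b => /=; lia.
Qed.

(** An east step inserted after a north step at level L starts at L + m, so it counts when -m < L -
    r < n. The old east steps with levels in [r + m, r + m + n) are the downward crossings of r + m;
    they are as many as the upward ones, the north steps with n <= L - r < m. The two ranges join to
    (-m, m). *)
Lemma dinv_row_expand m n s : (n < m)%N -> 0 <= level (m - n) n s ->
  let r := level (m - n) n s in
  (step_sum (fun u b => ~~ b && (r < level m n u < r + m%:Z + n%:Z)%R) (expand s)
   = step_sum (fun u b => ~~ b && (r < level (m - n) n u < r + m%:Z)%R) s
     + step_sum (fun u b => b && (- m%:Z < level (m - n) n u - r < m%:Z)%R) s)%N.
Proof.
move=> nm r0 r.
have T0 : 0 < r + m%:Z by lia.
have := @crossing (m - n) n (r + m%:Z) s T0.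
rewrite -/r (_ : (r + m%:Z <= r) = false) ?addn0; last by lia.
(* The upward crossings are added to both sides and, on the right, rewritten as downward crossings;
   the identity then holds step by step. *)
move=> cr; apply/eqP; rewrite -(eqn_add2r (step_sum (fun u b => b &&
   (r + m%:Z - (m - n)%:Z <= level (m - n) n u < r + m%:Z)) s)); apply/eqP.
rewrite -{2}cr {cr T0 r0}.
(* The level [r] is cut loose from [s], so that it stays fixed during the induction. *)
move: r => r; elim/last_ind: s => [|s b IH]; first by rewrite /= !step_sum_nil.
rewrite expand_rcons.
case: b; rewrite !step_sum_rcons ?level_rcons ?level_expand //=; lia.
Qed.

(** * Cells, dinv and area read off the word *)

Definition above_row (s : seq bool) (x v : nat) : bool :=
  has (fun k => [&& nth false s k, count id (take k s) == v
                  & (x < count negb (take k s))%N]) (iota 0 (size s)).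

Lemma aboveE a n (w : lpath a n) (c : cell a n) :
  above w c = above_row w c.1 c.2.
Proof.
apply/existsP/hasP => [[k /and3P[wk yk xk]] | [k]].
  exists (k : nat); first by rewrite mem_iota size_tuple ltn_ord.
  by move: wk; rewrite (tnth_nth false) => ->; rewrite yk.
rewrite mem_iota size_tuple /= => lek /and3P[wk yk xk].
by exists (Ordinal lek); rewrite (tnth_nth false) wk yk.
Qed.

(** Each row contains a single north step, so the existential in [above_row] has only [k] as
    witness. *)
Lemma above_row_north s x k : (k < size s)%N -> nth false s k ->
  above_row s x (count id (take k s)) = (x < count negb (take k s))%N.
Proof.
move=> ks sk; apply/hasP/idP => [[j]|xk]; last first.
  by exists k; rewrite ?mem_iota // sk eqxx.
rewrite mem_iota /= => js /and3P[sj /eqP jk xj].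
suff <- : j = k by [].
have [jk'|kj|//] := ltngtP j k.
- by have := @count_take_lt id s j k (ltnW ks) jk' sj; rewrite jk ltnn.
- by have := @count_take_lt id s k j (ltnW js) kj sk; rewrite jk ltnn.
Qed.

Lemma sum_ord_pairs a n (P : nat -> nat -> bool) :
  #|[set c : cell a n | P c.1 c.2]| =
  (\sum_(v < n) \sum_(x < a) P x v)%N.
Proof.
rewrite -sum1_card exchange_big /= pair_big /=.
rewrite big_mkcond /=; apply: eq_bigr => c _.
by rewrite inE; case: (P _ _).
Qed.

Lemma armE a n (w : lpath a n) (c : cell a n) :
  arm w c = (\sum_(x < a) (above_row w x c.2 && (c.1 < x)))%N.
Proof.
rewrite /arm (_ : [set d : cell a n | _] = [set d : cell a n |
  (fun x v => [&& above_row w x v, v == c.2 & c.1 < x])%N d.1 d.2]); last first.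
  by apply/setP => d; rewrite !inE aboveE -val_eqE.
rewrite (sum_ord_pairs _ _ (fun x v => [&& above_row w x v, v == c.2 & c.1 < x]%N)).
rewrite (bigD1 c.2) //= [X in (_ + X)%N]big1 ?addn0 => [|v].
  by apply: eq_bigr => x _; rewrite eqxx.
by rewrite -val_eqE /= => /negbTE vc; apply: big1 => x _; rewrite vc andbF.
Qed.

Lemma legE a n (w : lpath a n) (c : cell a n) :
  leg w c = (\sum_(v < n) (above_row w c.1 v && (v < c.2)))%N.
Proof.
rewrite /leg (_ : [set d : cell a n | _] = [set d : cell a n |
  (fun x v => [&& above_row w x v, x == c.1 & v < c.2])%N d.1 d.2]); last first.
  by apply/setP => d; rewrite !inE aboveE -val_eqE.
rewrite (sum_ord_pairs _ _ (fun x v => [&& above_row w x v, x == c.1 & v < c.2]%N)).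
apply: eq_bigr => v _.
rewrite (bigD1 c.1) //= [X in (_ + X)%N]big1 ?addn0 => [|x].
  by rewrite eqxx.
by rewrite -val_eqE /= => /negbTE vc; rewrite vc andbF.
Qed.

Lemma count_north_east s : (count id s + count negb s)%N = size s.
Proof. by rewrite -(count_predC id s); congr (_ + _)%N; apply: eq_count. Qed.

(** The dinv condition with arm [A] and leg [L], denominators cleared. For [L = 0] the last
    inequality holds when [n] is positive, which matches the convention on division by 0. *)
Definition dinv_at a n (s : seq bool) (x v : nat) : bool :=
  let A := (\sum_(x' < a) (above_row s x' v && (x < x')))%N in
  let L := (\sum_(v' < n) (above_row s x v' && (v' < v)))%N in
  [&& above_row s x v, (n * A < a * L.+1)%N & (a * L < n * A.+1)%N].

Lemma dinv_cellE a n (w : lpath a n) (c : cell a n) :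
  dinv_cell w c = dinv_at a n w c.1 c.2.
Proof.
have n0 : (0 < n)%N by case: c => _ [v]; lia.
rewrite /dinv_cell /dinv_at -armE -legE aboveE.
congr (_ && _); move: (arm _ _) (leg _ _) => A L.
congr (_ && _).
  rewrite ltr_pdivrMr ?ltr0n // mulrAC ltr_pdivlMr ?ltr0n //.
  by rewrite -!natrM ltr_nat mulnC.
have [->|L0] := posnP L; first by rewrite muln0 muln_gt0 n0.
rewrite /=.
rewrite ltr_pdivrMr ?ltr0n // mulrAC ltr_pdivlMr ?ltr0n //.
by rewrite -!natrM ltr_nat [(n * _)%N]mulnC.
Qed.

(* [b] stands for [a + n]; it is a separate argument because [m - n + n] is    *)
(* not convertible to [m].                                                     *)
Definition dinv_word (b a n : nat) (s : seq bool) : nat :=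
  step_sum (fun u c => if c then
     step_sum (fun v d => ~~ d &&
       (level a n u < level a n v < level a n u + b%:Z)%R) u
     else 0%N) s.

(** For the cell in the column of east step [j] and the row of north step [k], the level of [j]
    minus that of [k] is n (arm + 1) - a leg. Its positivity and its bound by a + n are the two dinv
    inequalities. *)
Lemma dinv_at_north a n s j k :
  size s = (a + n)%N -> count id s = n ->
  (j < k)%N -> (k < size s)%N -> ~~ nth false s j -> nth false s k ->
  dinv_at a n s (count negb (take j s)) (count id (take k s)) =
  (level a n (take k s) < level a n (take j s)
     < level a n (take k s) + (a + n)%:Z).
Proof.
move=> size_s count_s jk ks sj sk.
have count_e : count negb s = a by have := count_north_east s; lia.
have Xjk := @count_take_lt negb s j k (ltnW ks) jk sj.
have Yjk := @count_take_le id s j k (ltnW jk).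
have Xa : (count negb (take k s) <= a)%N.
  by rewrite -[X in (_ <= X)%N]count_e -{2}(take_size s) count_take_le // ltnW.
have Yn : (count id (take k s) <= n)%N.
  by rewrite -[X in (_ <= X)%N]count_s -{2}(take_size s) count_take_le // ltnW.
rewrite /dinv_at above_row_north // Xjk /=.
have -> : (\sum_(x' < a) (above_row s x' (count id (take k s)) &&
             (count negb (take j s) < x'))
          = count negb (take k s) - (count negb (take j s)).+1)%N.
  rewrite -(sum_interval _ Xa); apply: eq_bigr => x _.
  by rewrite above_row_north // andbC.
have -> : (\sum_(v' < n) (above_row s (count negb (take j s)) v' &&
             (v' < count id (take k s)))
          = count id (take k s) - count id (take j s))%N.
  rewrite -(sum_interval _ Yn).
  rewrite (@sum_count n id (fun v => above_row s (count negb (take j s)) v &&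
             (v < count id (take k s)))%N s) //.
  rewrite (@sum_count n id (fun v => (count id (take j s) <= v) &&
             (v < count id (take k s)))%N s) //.
  (* For a north step [i], both conditions say that [i] comes after the east step [j]. *)
  apply: eq_step_sum => i si; case si': (nth false s i) => //.
  rewrite above_row_north //; congr (nat_of_bool (_ && _)).
  have [ij|ji] := leqP i j.
    have ltij : (i < j)%N.
      by rewrite ltn_neqAle ij andbT; apply: contraNneq sj => <-.
    have := @count_take_le negb s i j ij.
    have js : (j <= size s)%N by lia.
    by have := @count_take_lt id s i j js ltij si'; lia.
  have := @count_take_lt negb s j i (ltnW si) ji sj.
  by have := @count_take_le id s j i (ltnW ji); lia.
rewrite /level.
move: (count id _) (count negb _) (count id _) (count negb _) Xjk Yjk {Xa Yn}.
move=> Yk Xk Yj Xj Xjk Yjk.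
have [d ->] : exists d, Xk = (Xj + d.+1)%N by exists (Xk - Xj.+1)%N; lia.
have [e ->] : exists e, Yk = (Yj + e)%N by exists (Yk - Yj)%N; lia.
rewrite (_ : (Xj + d.+1 - Xj.+1)%N = d); last by lia.
rewrite (_ : (Yj + e - Yj)%N = e); last by lia.
by apply/idP/idP; nia.
Qed.

Lemma dinvE a n b (w : lpath a n) : (a + n)%N = b -> count id w = n ->
  dinv w = dinv_word b a n w.
Proof.
move=> <- cw.
have sw : size w = (a + n)%N by rewrite size_tuple.
have cw' : count negb w = a by have := count_north_east w; lia.
rewrite /dinv (_ : [set c | _] = [set c : cell a n | dinv_at a n w c.1 c.2]);
  last by apply/setP => c; rewrite !inE dinv_cellE.
rewrite sum_ord_pairs.
rewrite (@sum_count n id (fun v => \sum_(x < a) dinv_at a n w x v)%N w) //.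
apply: eq_step_sum => k ks; case wk: (nth false w k) => //.
have Xa : (count negb (take k w) <= a)%N.
  by rewrite -[X in (_ <= X)%N]cw' -{2}(take_size w) count_take_le // ltnW.
(* Only columns left of the north step contain cells above the path in its row; they correspond to
   the east steps before it. *)
rewrite (bigID (fun x : 'I_a => (x < count negb (take k w))%N)) /=.
rewrite [X in (_ + X)%N]big1 ?addn0 => [|x]; last first.
  by rewrite /dinv_at above_row_north // => /negbTE ->.
rewrite -(big_ord_widen a
  (fun x => nat_of_bool (dinv_at a n w x (count id (take k w))))) //.
rewrite (@sum_count _ negb
  (fun x => nat_of_bool (dinv_at a n w x (count id (take k w)))) (take k w)) //.
apply: eq_step_sum => j; rewrite size_take ks => jk.
rewrite nth_take // take_takel //; last exact: ltnW.
by case wj: (nth false w j) => //=; rewrite dinv_at_north ?wj.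
Qed.

(* A row whose north step starts at level l has (l - 1) / n cells of positive  *)
(* rank below the path, and none if l = 0.                                     *)
Definition area_word (a n : nat) (s : seq bool) : nat :=
  step_sum (fun u c => if c then (`|level a n u|.-1 %/ n)%N else 0%N) s.

Lemma areaE a n (w : lpath a n) : (0 < n)%N -> count id w = n ->
  (forall k, (k <= a + n)%N -> 0 <= level a n (take k w)) ->
  area w = area_word a n w.
Proof.
move=> n0 cw dyck.
have sw : size w = (a + n)%N by rewrite size_tuple.
have cw' : count negb w = a by have := count_north_east w; lia.
rewrite /area (_ : [set c : cell a n | _] = [set c : cell a n |
   (fun x v => ~~ above_row w x v && (0 < rank a n x.+1 v.+1)) c.1 c.2]);
  last by apply/setP => c; rewrite !inE aboveE.
rewrite (sum_ord_pairs _ _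
  (fun x v => ~~ above_row w x v && (0 < rank a n x.+1 v.+1))).
rewrite (@sum_count n id (fun v =>
  \sum_(x < a) (~~ above_row w x v && (0 < rank a n x.+1 v.+1)%R))%N w) //.
apply: eq_step_sum => k ks; case wk: (nth false w k) => //.
have lev0 : 0 <= level a n (take k w) by apply: dyck; lia.
have Yn : (count id (take k w) <= n)%N.
  by rewrite -[X in (_ <= X)%N]cw -{2}(take_size w) count_take_le // ltnW.
(* In this row the cell in 0-based column [x] has rank level - n (x - X + 1), with X the abscissa of
   the north step. So [C] is the first column past the cells counted by the area. *)
set C := (count negb (take k w) + `|level a n (take k w)|.-1 %/ n)%N.
have Ca : (C <= a)%N.
  have h := leq_trunc_div `|level a n (take k w)|.-1 n.
  rewrite /C; move: h; set q := (_ %/ n)%N => h.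
  move: lev0 h; rewrite /level.
  move: (count id _) (count negb _) Yn => Y X Yn lev0 h.
  rewrite -(leq_pmul2r n0); nia.
rewrite -[RHS](addKn (count negb (take k w))) -/C -(sum_interval _ Ca).
apply: eq_bigr => x _; rewrite above_row_north // -leqNgt.
case: (leqP (count negb (take k w)) x) => //= Xx; congr nat_of_bool.
rewrite /C (_ : (x < _ + _)%N = (x.+1 - count negb (take k w)
                  <= `|level a n (take k w)|.-1 %/ n)%N); last by lia.
rewrite leq_divRL // /rank; move: lev0; rewrite /level.
move: (count id _) (count negb _) Xx {Yn Ca C} => Y X Xx lev0.
have [d xd] : exists d, (x = X + d :> nat)%N by exists (x - X)%N; lia.
rewrite xd (_ : ((X + d).+1 - X)%N = d.+1); last by lia.
by apply/idP/idP; nia.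
Qed.

(** * The Dyck condition and the ranks as levels of north steps *)

Definition dyck_word a n (s : seq bool) : Prop :=
  forall k, 0 <= level a n (take k s).

Lemma dyck_word_rcons a n s b :
  dyck_word a n (rcons s b) <-> dyck_word a n s /\ 0 <= level a n (rcons s b).
Proof.
split=> [d|[d l0] k].
  split=> [k|]; last by have := d (size (rcons s b)); rewrite take_size.
  have [ks|sk] := leqP k (size s).
    by have := d k; rewrite -cats1 takel_cat.
  rewrite take_oversize ?(ltnW sk) //.
  by have := d (size s); rewrite -cats1 take_size_cat.
have [ks|sk] := leqP k (size s).
  by rewrite -cats1 takel_cat.
by rewrite take_oversize // size_rcons.
Qed.

Lemma dyck_word_level a n s : dyck_word a n s -> 0 <= level a n s.
Proof. by move/(_ (size s)); rewrite take_size. Qed.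

Lemma dyck_word_expand m n s : (n < m)%N ->
  dyck_word m n (expand s) <-> dyck_word (m - n) n s.
Proof.
move=> nm; elim/last_ind: s => [|s b IH].
  by split=> _ k /=; rewrite /level /=; lia.
rewrite expand_rcons dyck_word_rcons -IH.
have lv : dyck_word m n (expand s) -> 0 <= level (m - n) n s.
  by move/dyck_word_level; rewrite level_expand.
case: b; rewrite !dyck_word_rcons !level_rcons level_expand //.
  split=> [[[d _] l0]|[d l0]]; first by split=> //; lia.
  by move/lv: (d) => lv0; split; [split|]; rewrite // ; lia.
Qed.

Lemma is_dyckP a n (w : lpath a n) :
  is_dyck w <-> count id w = n /\ dyck_word a n w.
Proof.
have sw : size w = (a + n)%N by rewrite size_tuple.
have cw' := count_north_east w.
have tw : take (a + n) w = w by rewrite take_oversize ?sw.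
rewrite /is_dyck /xpos /ypos tw; split.
  case/and3P=> _ /eqP cw /forallP d; split=> // k.
  have [ks|sk] := leqP k (a + n)%N.
    by have /= := d (Ordinal (ks : (k < (a + n).+1)%N)); rewrite /level; lia.
  rewrite take_oversize ?sw 1?ltnW //.
  by have /= := d ord_max; rewrite tw /level; lia.
case=> cw d; apply/and3P; split; [by lia|by lia|].
by apply/forallP => k; have := d k; rewrite /level; lia.
Qed.

Definition norths a n (s : seq bool) : seq int :=
  [seq level a n (take k s) | k <- iota 0 (size s) & nth false s k].

Lemma norths_rcons a n s b :
  norths a n (rcons s b) =
  if b then rcons (norths a n s) (level a n s) else norths a n s.
Proof.
rewrite /norths size_rcons -addn1 iotaD filter_cat map_cat /= add0n.
rewrite nth_rcons ltnn eqxx.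
have -> : [seq level a n (take k (rcons s b)) | k <- iota 0 (size s)
             & nth false (rcons s b) k] = norths a n s.
  rewrite /norths (eq_in_filter (a2 := fun k => nth false s k)) => [|k].
    apply/eq_in_map => k; rewrite mem_filter mem_iota => /andP[_ /= ks].
    by rewrite -cats1 takel_cat 1?ltnW.
  by rewrite mem_iota /= => ks; rewrite nth_rcons ks.
case: b; last by rewrite cats0.
by rewrite /= -cats1 takel_cat // take_size -cats1.
Qed.

Lemma norths_expand m n s : (n < m)%N ->
  norths m n (expand s) = norths (m - n) n s.
Proof.
move=> nm; elim/last_ind: s => [|s b IH] //.
by rewrite expand_rcons; case: b; rewrite !norths_rcons IH // level_expand.
Qed.

Lemma sum_norths a n (G : int -> nat) s :
  step_sum (fun u b => if b then G (level a n u) else 0%N) s =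
  (\sum_(l <- norths a n s) G l)%N.
Proof.
elim/last_ind: s => [|s b IH]; first by rewrite step_sum_nil /norths big_nil.
rewrite step_sum_rcons norths_rcons IH.
by case: b; rewrite ?big_rcons ?addn0 //= addnC.
Qed.

Lemma size_norths a n s : size (norths a n s) = count id s.
Proof.
elim/last_ind: s => [|s b IH] //.
rewrite norths_rcons -[in RHS]cats1 count_cat /= -IH.
by case: b; rewrite ?size_rcons ?addn0 ?addn1.
Qed.

Lemma northsP a n s l : l \in norths a n s ->
  exists2 k, ((k < size s)%N /\ nth false s k) & l = level a n (take k s).
Proof.
case/mapP=> k; rewrite mem_filter mem_iota => /andP[sk ks] ->.
by exists k.
Qed.

Lemma mem_norths a n s k : (k < size s)%N -> nth false s k ->
  level a n (take k s) \in norths a n s.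
Proof.
by move=> ks sk; apply/mapP; exists k => //; rewrite mem_filter sk mem_iota.
Qed.

Lemma level_eq_dvd a n y y' x x' : coprime a n -> 
  a%:Z * y%:Z - n%:Z * x%:Z = a%:Z * y'%:Z - n%:Z * x'%:Z -> 
  (n%:Z %| y%:Z - y'%:Z)%Z.
Proof.
move=> an e; rewrite -(@Gauss_dvdzr _ a%:Z).
  by apply/dvdzP; exists (x%:Z - x'%:Z); lia.
by rewrite /coprimez gcdzC.
Qed.

(** By coprimality, equal levels force heights congruent modulo [n], while the north steps start at
    distinct heights below [n]. *)
Lemma uniq_norths a n s : coprime a n -> (count id s <= n)%N ->
  uniq (norths a n s).
Proof.
move=> an; elim/last_ind: s => [|s b IH] //.
rewrite norths_rcons -[in (_ <= n)%N]cats1 count_cat /= addn0.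
case: b => /= cs; last by apply: IH; lia.
rewrite rcons_uniq IH ?andbT; last by lia.
apply/negP => /northsP[k [ks sk]].
rewrite /level => /(level_eq_dvd an) h.
have := @count_take_lt id s k (size s) (leqnn _) ks sk.
rewrite take_size; move: h; move: (count id s) (count id _) cs => Y y cs.
case/dvdzP => q e yY; have [q0|q0] : q <= 0 \/ 1 <= q by lia.
  by nia.
by nia.
Qed.

Lemma RranksE a n (w : lpath a n) :
  Rranks w = [seq l - n%:Z | l <- norths a n w].
Proof.
rewrite /Rranks /norths -map_comp size_tuple -val_enum_ord filter_map -map_comp.
rewrite (eq_filter (a2 := fun k : 'I_(a + n) => tnth w k)) => [|k]; last first.
  by rewrite /= (tnth_nth false).
apply: eq_map => k /=; rewrite /rank /level /xpos /ypos; lia.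
Qed.

(** * Inversions, and the effect of [expand] on dinv and area *)

(** For duplicate-free [R], the inversions of its decreasing ordering, in a form that ignores the
    order of [R]. *)
Definition inv_count (m : nat) (R : seq int) : nat :=
  (\sum_(k <- R) \sum_(l <- R) (l < k < l + m%:Z)%R)%N.

(** The new entry forms an inversion with [l], in exactly one of the two roles, when they are
    distinct and less than [m] apart. *)
Lemma inv_count_rcons m R r : r \notin R ->
  inv_count m (rcons R r) =
  (inv_count m R + \sum_(l <- R) (- m%:Z < l - r < m%:Z)%R)%N.
Proof.
move=> rR; rewrite /inv_count big_rcons /= big_rcons /=.
under eq_bigr => k _ do rewrite big_rcons /=.
rewrite big_split /= ltxx addn0 -addnA; congr (_ + _)%N.
rewrite -big_split /= big_seq [RHS]big_seq; apply: eq_bigr => l lR.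
have : l != r by apply: contraNneq rR => <-.
by lia.
Qed.

Lemma perm_inv_count m R R' : perm_eq R R' -> inv_count m R = inv_count m R'.
Proof.
move=> RR'; rewrite /inv_count (perm_big _ RR') /=.
by apply: eq_bigr => k _; rewrite (perm_big _ RR').
Qed.

Lemma inv_count_shift m R (c : int) :
  inv_count m [seq l - c | l <- R] = inv_count m R.
Proof.
rewrite /inv_count big_map; apply: eq_bigr => k _.
by rewrite big_map; apply: eq_bigr => l _; lia.
Qed.

(** Each further north step adds one instance of [dinv_row_expand], whose last sum is the increment
    in [inv_count_rcons]. *)
Lemma dinv_word_expand m n s : (n < m)%N ->
  dyck_word (m - n) n s -> uniq (norths (m - n) n s) ->
  dinv_word (m + n) m n (expand s) =
  (dinv_word m (m - n) n s + inv_count m (norths (m - n) n s))%N.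
Proof.
move=> nm; elim/last_ind: s => [|s b IH].
  by move=> _ _; rewrite /dinv_word /inv_count /norths /= !step_sum_nil big_nil.
rewrite dyck_word_rcons norths_rcons expand_rcons => -[d _].
rewrite /dinv_word.
case: b; rewrite !step_sum_rcons ?addn0; last by move=> u; apply: IH.
rewrite rcons_uniq => /andP[lR uR].
rewrite -!/(dinv_word _ _ _ _) IH // inv_count_rcons // -!addnA.
congr (_ + _)%N; rewrite addnCA; congr (_ + _)%N.
rewrite !level_expand //.
rewrite -(sum_norths (m - n) n (fun l => - m%:Z < l - _ < m%:Z)%R).
have := dinv_row_expand nm (dyck_word_level d) => /= e.
etransitivity; last (etransitivity; first exact: e).
  by apply: eq_step_sum => k _; rewrite PoszD addrA.
by congr (_ + _)%N; apply: eq_step_sum => k _; case: nth.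
Qed.

Lemma area_word_expand m n s : (n < m)%N ->
  area_word m n (expand s) = area_word (m - n) n s.
Proof.
move=> nm; elim/last_ind: s => [|s b IH]; first by rewrite /area_word !step_sum_nil.
rewrite expand_rcons; move: IH; rewrite /area_word => IH.
by case: b; rewrite !step_sum_rcons IH ?level_expand ?addn0.
Qed.

(** * Consecutive north steps and pairs [k], [k + m] in R *)

Lemma path_not_bothP s :
  path not_both false (rcons s true) <->
  forall i, (i < size s)%N -> nth false s i ->
    (i.+1 < size s)%N /\ ~~ nth false s i.+1.
Proof.
have -> : path not_both false (rcons s true) = sorted not_both (rcons s true).
  by case: s.
split=> [/(sortedP false) h i si wi|h].
  have := h i; rewrite size_rcons ltnS si !nth_rcons si wi => /(_ isT).
  by case: (ltngtP i.+1 (size s)) => //; rewrite ltnNge si.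
apply/(sortedP false) => i; rewrite size_rcons ltnS !nth_rcons => si.
rewrite si /not_both negb_and orbC -implyNb negbK.
apply/implyP; case: ifP => [si' wi'|].
  by apply/negP => wi; have [_] := h i si wi; rewrite wi'.
move=> si' _; apply/negP => wi; have [] := h i si wi.
by rewrite si'.
Qed.

(** A final north step of a Dyck path would start at level -m, so a failure of the condition comes
    from two adjacent north steps, whose starting levels differ by [m]. *)
Lemma norths_consecutive m n (w : lpath m n) : (0 < m)%N -> is_dyck w ->
  ~~ path not_both false (rcons w true) ->
  exists2 k, k \in norths m n w & k + m%:Z \in norths m n w.
Proof.
move=> m0 /is_dyckP[cw d] np.
have [/existsP[i /andP[wi wi']]|] := boolP [exists i : 'I_(size w),
    nth false w i && nth false (rcons w true) i.+1]; last first.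
  rewrite negb_exists => /forallP h; case/negP: np.
  apply/path_not_bothP => i si wi.
  have := h (Ordinal si); rewrite /= wi nth_rcons /=.
  by case: (ltngtP i.+1 (size w)) => //; rewrite ltnNge si.
have lv : level m n (take i.+1 w) = level m n (take i w) + m%:Z.
  by rewrite (take_nth false) // level_rcons wi.
exists (level m n (take i w)); first exact: mem_norths.
rewrite -lv; move: wi'; rewrite nth_rcons.
case: (ltngtP i.+1 (size w)) => // [si wi'|si _]; first exact: mem_norths.
move: lv; rewrite si take_size.
have := d i; rewrite /level cw.
have cw' := count_north_east w; rewrite cw size_tuple in cw'.
by rewrite (_ : count negb w = m); lia.
Qed.

(** If such a pair existed, one north step would end at the level where the other starts; by
    coprimality these two points have heights congruent modulo [n]. *)
Lemma norths_not_consecutive m n (w : lpath m n) k : (0 < m)%N ->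
  coprime m n -> is_dyck w -> path not_both false (rcons w true) ->
  k \in norths m n w -> k + m%:Z \notin norths m n w.
Proof.
move=> m0 mn /is_dyckP[cw d] /path_not_bothP nb /northsP[i [si wi] ->].
apply/negP => /northsP[j [sj wj]]; rewrite /level.
have di := d i; have dj := d j.
have xi := count_north_east (take i w).
have xj := count_north_east (take j w).
rewrite !size_takel ?(ltnW si) ?(ltnW sj) // in xi xj.
have := @count_take_lt id w i (size w) (leqnn _) si wi.
have := @count_take_lt id w j (size w) (leqnn _) sj wj.
rewrite take_size cw; move: di dj xi xj; rewrite /level.
move: (count id _) (count negb _) (count id _) (count negb _).
move=> yj xj yi xi di dj ei ej yjn yin e.
have e' : m%:Z * yi.+1%:Z - n%:Z * xi%:Z = m%:Z * yj%:Z - n%:Z * xj%:Z by lia.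
have /dvdzP[q eq] := level_eq_dvd mn e'.
(* The bounds on the heights exclude all but q = 0 and q = 1. For q = 0 step [j] directly follows
   step [i]. For q = 1 step [j] starts at height 0, hence at level at most 0, although its level is
   at least [m]. *)
have [q0|[q0|[q0|q0]]] : q <= -1 \/ q = 0 \/ q = 1 \/ 2 <= q by lia.
- by nia.
- rewrite q0 mul0r in eq.
  have yji : yj = yi.+1 by lia.
  have n0 : (0 < n)%N by lia.
  have xji : xj = xi by rewrite yji in e'; nia.
  have ji : j = i.+1 by lia.
  by have [_] := nb i si wi; rewrite -ji wj.
- have yi0 : yi = n.-1 by lia.
  have yj0 : yj = 0%N by lia.
  by nia.
- by nia.
Qed.

(** * Linear independence of the F_S *)

(* The index sequence that increases exactly at the positions outside [T], so  *)
(* that F_S has coefficient [T \subset S] at its monomial.                     *)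
Definition stair n (T : {set 'I_n.-1}) : seq nat :=
  mkseq (fun j => \sum_(i < n.-1) ((i < j)%N && (i \notin T)))%N n.

Lemma stair_step n (T : {set 'I_n.-1}) (j : 'I_n.-1) :
  nth 0%N (stair T) j.+1 = (nth 0 (stair T) j + (j \notin T))%N.
Proof.
have jn := ltn_ord j.
rewrite !nth_mkseq; try lia.
rewrite [LHS](bigD1 j) //= [X in _ = (X + _)%N](bigD1 j) //= ltnn leqnn add0n /=.
rewrite addnC; congr (_ + _)%N; apply: eq_bigr => i ij.
by congr (nat_of_bool (_ && _)); move: ij; rewrite -val_eqE /=; lia.
Qed.

Lemma sorted_compatible n (S : {set 'I_n.-1}) s :
  compatible S s -> sorted leq s.
Proof.
case/and3P=> /eqP sn /forallP h _; apply/(sortedP 0%N) => i.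
rewrite sn => si.
have si' : (i < n.-1)%N by lia.
by have := h (Ordinal si').
Qed.

(** Compatible sequences are nondecreasing, and the only nondecreasing arrangement of this multiset
    is [stair T] itself. *)
Lemma Fqsym_stair n (S T : {set 'I_n.-1}) :
  Fqsym S (seq_mset (stair T)) = (T \subset S)%:R.
Proof.
rewrite /Fqsym; congr (_%:R).
have step := stair_step T.
have sT : sorted leq (stair T).
  apply/(sortedP 0%N) => i; rewrite size_mkseq => si.
  have si' : (i < n.-1)%N by lia.
  by rewrite (step (Ordinal si')) leq_addr.
have -> : (T \subset S) = compatible S (stair T).
  rewrite /compatible size_mkseq eqxx /=.
  have -> /= : [forall j : 'I_n.-1, (nth 0 (stair T) j <= nth 0 (stair T) j.+1)%N].
    by apply/forallP => j; rewrite step leq_addr.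
  apply/subsetP/forallP => [TS j|h j].
    apply/implyP => jS; rewrite step (contra (TS j)) //; lia.
  apply: contraTT => jS; have := h j.
  by rewrite jS /= step; lia.
rewrite -[LHS]sum1_count.
have pT : stair T \in permutations (seq_mset (stair T) : seq nat).
  by rewrite mem_permutations perm_sym perm_eq_seq_mset.
rewrite big_mkcond (bigD1_seq _ pT) ?permutations_uniq //=.
rewrite big_seq_cond big1 ?addn0; first by case: compatible.
move=> s /andP[]; rewrite mem_permutations => sp.
case: ifP => // /sorted_compatible ss /eqP[].
apply: (sorted_eq leq_trans anti_leq) => //.
by apply: perm_trans sp _; apply: perm_eq_seq_mset.
Qed.

(* The matrix [T \subset S] is unitriangular for inclusion. *)
Lemma Fqsym_free n (d : {set 'I_n.-1} -> qtfrac) :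
  (forall mu, \sum_S d S * Fqsym S mu = 0) -> forall S, d S = 0.
Proof.
(* Descending induction from the full set: at the monomial of [stair S] only supersets of [S]
   contribute, and the strict ones are already known to have coefficient 0. *)
move=> h S; have [k] := ubnP #|~: S|; elim: k S => // k IH S kS.
have := h (seq_mset (stair S)); rewrite (bigD1 S) //= Fqsym_stair subxx mulr1.
rewrite big1 ?addr0 // => S' S'S; rewrite Fqsym_stair.
have [SS'|] := boolP (S \subset S'); last by rewrite mulr0.
rewrite IH ?mul0r // -ltnS; apply: leq_trans kS; rewrite ltnS.
apply: proper_card; rewrite properEneq setCS SS' andbT.
by apply: contraNneq S'S => /setC_inj ->.
Qed.

(** * The coefficients of the Hikita polynomial, and the one of F_[n-1] *)

Definition Hikita_coef m n (S : {set 'I_n.-1}) : qtfrac :=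
  \sum_(w : lpath m n | is_dyck w)
    \sum_(W <- permutations (Rranks w) | is_parking w W && (des n W == S))
      (tofrac tvar) ^+ area w * (tofrac qvar) ^ pdinv w W.

Lemma Hikita_expansion m n : F_expansion (Hikita m n) (@Hikita_coef m n).
Proof.
move=> mu; rewrite /Hikita /Hikita_coef.
under [RHS]eq_bigr do rewrite mulr_suml.
rewrite exchange_big /=; apply: eq_bigr => w _.
under [RHS]eq_bigr do rewrite mulr_suml.
rewrite (exchange_big_dep (fun W => is_parking w W)) /=; last first.
  by move=> S W _ /andP[].
apply: eq_bigr => W pW; rewrite (big_pred1 (des n W)) // => S.
by rewrite pW eq_sym.
Qed.

Lemma des_setT n (W : seq int) : size W = n ->
  (des n W == setT) = sorted (fun x y => y < x) W.
Proof.
move=> sW; apply/eqP/(sortedP 0) => [dT i|h].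
  rewrite sW => si; have si' : (i < n.-1)%N by lia.
  by have := in_setT (Ordinal si'); rewrite -dT inE.
apply/setP => i; rewrite !inE; apply: h; rewrite sW.
by have := ltn_ord i; lia.
Qed.

Lemma inversions_decreasing m n (W : seq int) : size W = n ->
  sorted (fun x y => y < x) W -> inversions m n W = inv_count m W.
Proof.
move=> sW dW.
have gtr_trans : transitive (fun x y : int => y < x).
  by move=> x y z xy zx; apply: lt_trans xy.
rewrite /inversions /inv_count -sum1_card (big_nth 0) big_mkord sW.
under [RHS]eq_bigr do rewrite (big_nth 0) big_mkord sW.
rewrite pair_big /= big_mkcond /=; apply: eq_bigr => -[i j] _.
rewrite inE /=; have [ij|ji] := ltnP i j; first by case: (X in nat_of_bool X).
rewrite /= -ltnS in ji *.
have -> // : (W`_j < W`_i) = false.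
move: ji; rewrite ltnS leq_eqVlt => /orP[/eqP->|ji]; first exact: ltxx.
apply: le_gtF; apply: ltW.
by apply: (sorted_ltn_nth gtr_trans); rewrite ?inE ?sW.
Qed.

Definition decreasing (R : seq int) := rev (sort <=%O R).

Lemma perm_decreasing R : perm_eq (decreasing R) R.
Proof. by rewrite perm_rev perm_sort. Qed.

Lemma sorted_decreasing R : uniq R ->
  sorted (fun x y => y < x) (decreasing R).
Proof. by move=> uR; rewrite rev_sorted sort_lt_sorted. Qed.

Lemma decreasing_unique R W : uniq R -> perm_eq W R ->
  sorted (fun x y => y < x) W -> W = decreasing R.
Proof.
move=> uR pW sW; apply: (sorted_eq _ _ sW (sorted_decreasing uR)).
- by move=> x y z xy zx; apply: lt_trans xy.
- by move=> x y /andP[xy yx]; have := lt_trans xy yx; rewrite ltxx.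
- by rewrite (perm_trans pW) // perm_sym perm_decreasing.
Qed.

Lemma uniq_Rranks m n (w : lpath m n) : coprime m n -> is_dyck w ->
  uniq (Rranks w).
Proof.
move=> mn /is_dyckP[cw _]; rewrite RranksE map_inj_uniq; last exact: addIr.
by rewrite uniq_norths // cw.
Qed.

Lemma size_Rranks m n (w : lpath m n) : is_dyck w -> size (Rranks w) = n.
Proof. by move=> /is_dyckP[cw _]; rewrite RranksE size_map size_norths. Qed.

(** A decreasing ordering puts [k + m] left of [k], so the parking condition can only hold
    vacuously, when R contains no such pair. *)
Lemma parking_decreasing m n (w : lpath m n) : (0 < m)%N -> coprime m n ->
  is_dyck w ->
  is_parking w (decreasing (Rranks w)) = path not_both false (rcons w true).
Proof.
move=> m0 mn dw; rewrite /is_parking dw perm_decreasing /=.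
have uR := uniq_Rranks mn dw.
have shift k : (k \in Rranks w) = (k + n%:Z \in norths m n w).
  rewrite RranksE -[in LHS](addrK n%:Z k) (mem_map (f := fun l => l - n%:Z)) //.
  exact: addIr.
have [p|np] := boolP (path _ _ _).
  apply/allP => k; rewrite !shift => kR; rewrite addrAC.
  by rewrite (negbTE (norths_not_consecutive m0 mn dw p kR)).
have [k kR kmR] := norths_consecutive m0 dw np.
apply/negbTE/negP => /allP /(_ (k - n%:Z)).
have e : k - n%:Z + m%:Z + n%:Z = k + m%:Z by rewrite addrAC subrK.
rewrite !shift e subrK => /(_ kR); rewrite kmR /=.
have gtr_trans : transitive (fun x y : int => y < x).
  by move=> x y z xy zx; apply: lt_trans xy.
move/(sorted_ltn_index gtr_trans (sorted_decreasing uR)).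
by rewrite !(perm_mem (perm_decreasing _)) !shift e subrK => /(_ kR kmR); lia.
Qed.

(** Descent set [n-1] means strictly decreasing, so each path contributes at most through the unique
    decreasing ordering of its ranks. *)
Lemma Hikita_coef_setT m n : (0 < m)%N -> coprime m n ->
  @Hikita_coef m n setT =
  \sum_(w : lpath m n | is_dyck w && path not_both false (rcons w true))
    (tofrac tvar) ^+ area w *
    (tofrac qvar) ^ ((dinv w)%:Z - (inv_count m (norths m n w))%:Z).
Proof.
move=> m0 mn; rewrite /Hikita_coef [RHS]big_mkcondr; apply: eq_bigr => w dw.
have uR := uniq_Rranks mn dw.
have pR : decreasing (Rranks w) \in permutations (Rranks w).
  by rewrite mem_permutations perm_decreasing.
rewrite big_mkcond (bigD1_seq _ pR) ?permutations_uniq //=.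
have sR W : perm_eq W (Rranks w) -> size W = n.
  by move/perm_size->; apply: size_Rranks.
rewrite parking_decreasing // des_setT ?sR ?perm_decreasing //.
rewrite sorted_decreasing // andbT big_seq_cond big1 ?addr0.
  case: ifP => // _; rewrite /pdinv inversions_decreasing ?sorted_decreasing //.
    rewrite (perm_inv_count _ (perm_decreasing _)) RranksE inv_count_shift //.
  by rewrite sR ?perm_decreasing.
move=> W /andP[]; rewrite mem_permutations => pW WR.
case: ifP => // /andP[_]; rewrite des_setT ?sR // => sW.
by rewrite (decreasing_unique uR pW sW) eqxx in WR.
Qed.

Theorem mainTheorem2 (m n : nat) (hm : (0 < m)%N) (hn : (0 < n)%N)
    (hmn : coprime m n) (hlt : (n < m)%N) :
  exists c : {set 'I_n.-1} -> qtfrac,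
    [/\ F_expansion (Hikita m n) c,
        (forall c' : {set 'I_n.-1} -> qtfrac,
            F_expansion (Hikita m n) c' -> forall S, c' S = c S)
      & c [set: 'I_n.-1] = tofrac (qtCatalan (m - n) n)].
Proof.
exists (@Hikita_coef m n); split; first exact: Hikita_expansion.
  move=> c' hc' S; apply/eqP; rewrite -subr_eq0; apply/eqP; move: S.
  apply: (@Fqsym_free n (fun S => c' S - Hikita_coef m S)) => mu.
  under eq_bigr do rewrite mulrBl.
  by rewrite big_split /= sumrN -hc' -Hikita_expansion subrr.
rewrite Hikita_coef_setT // /qtCatalan rmorph_sum /=.
(* The default tuples only make the maps total: [expand] yields the right size when [w] has [n]
   north steps, [contract] when [w] is a Dyck path without consecutive north steps. *)
pose widen (w : lpath (m - n) n) : lpath m n :=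
  insubd [tuple of nseq (m + n) false] (expand w).
pose narrow (w : lpath m n) : lpath (m - n) n :=
  insubd [tuple of nseq (m - n + n) false] (contract false w).
have widenE (w : lpath (m - n) n) : count id w = n -> widen w = expand w :> seq bool.
  by move=> cw; rewrite val_insubd size_expand cw size_tuple ifT //; lia.
have narrowE (w : lpath m n) : is_dyck w -> path not_both false (rcons w true) ->
    expand (narrow w) = w.
  move=> /is_dyckP[cw _] /contractK ew; rewrite val_insubd.
  have := size_expand (contract false w); rewrite -count_expand ew cw size_tuple.
  by move=> e; rewrite ifT //; apply/eqP; lia.
have narrow_dyck (w : lpath m n) : is_dyck w ->
    path not_both false (rcons w true) -> is_dyck (narrow w).
  move=> dw pw; apply/is_dyckP; rewrite -count_expand -dyck_word_expand //.
  by rewrite narrowE //; apply/is_dyckP.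
have count_dyck a (w : lpath a n) : is_dyck w -> count id w = n.
  by move/is_dyckP => [].
rewrite (reindex_onto widen narrow); last first.
  move=> w /andP[dw pw]; apply: val_inj; rewrite /= widenE ?narrowE //.
  exact/count_dyck/narrow_dyck.
have widen_dyck (w : lpath (m - n) n) : is_dyck w -> is_dyck (widen w).
  move=> dw; have cw := count_dyck _ _ dw; apply/is_dyckP.
  by rewrite widenE // count_expand dyck_word_expand //; apply/is_dyckP.
apply: eq_big => [w|w /andP[/andP[dw pw] /eqP nw]].
  apply/idP/idP => [/andP[/andP[dw pw] /eqP <-]|dw]; first exact: narrow_dyck.
  have ew := widenE w (count_dyck _ _ dw).
  rewrite widen_dyck // ew path_expand /=; apply/eqP/val_inj.
  by rewrite val_insubd ew expandK ifT ?size_tuple.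
have dw' : is_dyck w by rewrite -nw; apply: narrow_dyck.
have ew := widenE w (count_dyck _ _ dw').
have [cw d] := (is_dyckP _).1 dw'; have [cw2 d2] := (is_dyckP _).1 dw.
rewrite !areaE // (dinvE (erefl _) cw2) (dinvE (subnK (ltnW hlt)) cw) ew.
rewrite area_word_expand // norths_expand //.
have cop : coprime (m - n) n.
  by rewrite coprime_sym /coprime -gcdnDl subnKC 1?ltnW // -/(coprime n m) coprime_sym.
(* The inversions cancel, so the integer exponent of q becomes the natural number dinv of the narrow
   path. *)
rewrite dinv_word_expand ?uniq_norths ?cw // PoszD addrK.
by rewrite rmorphM !rmorphXn mulrC.
Qed.
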